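(* Let $\mathcal{C}$ be a ribbon fusion category over $\mathbb{C}$ with twist $\theta$ and braiding $c$, and let $M_{V,W}=c_{W,V}\circ c_{V,W}$ for $V,W\in\mathcal{C}$. Then $\mathrm{ord}(\theta)=\mathrm{ord}(M)$ or $\mathrm{ord}(\theta)=2\,\mathrm{ord}(M)$.
   Context: A fusion category over $\mathbb{C}$ is a rigid $\mathbb{C}$-linear semisimple monoidal category with finite-dimensional morphism spaces, finitely many isomorphism classes of simple objects, simple unit object, and $\mathrm{End}(X)=\mathbb{C}$ for simple $X$. Ribbon: braided with a twist $\theta$, i.e. an automorphism of the identity functor with $\theta_{V\otimes W}=(\theta_V\otimes\theta_W)c_{W,V}c_{V,W}$, $\theta_I=\mathrm{id}_I$, and $\theta_{V^\vee}=(\theta_V)^\vee$. $\mathrm{ord}(\theta)$ is the least $n\ge1$ with $\theta_V^n=\mathrm{id}_V$ for all $V$, and $\mathrm{ord}(M)$ the least $n\ge1$ with $M_{V,W}^n=\mathrm{id}_{V\otimes W}$ for all $V,W$. It is known (Etingof) that both orders are finite and $\mathrm{ord}(M)\mid\mathrm{ord}(\theta)$. *)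

(* Defs.v *)
From HB Require Import structures.
From mathcomp Require Import all_boot all_order all_algebra.
From mathcomp Require Import boolp classical_sets reals.
From mathcomp Require Import complex.

Set Implicit Arguments.
Unset Strict Implicit.
Unset Printing Implicit Defensive.

Import GRing.Theory.
Local Open Scope ring_scope.

Declare Scope cat_scope.
Delimit Scope cat_scope with cat.

Reserved Notation "g ∘ f" (at level 40, left associativity).
Reserved Notation "X ⊗ Y" (at level 35, right associativity).
Reserved Notation "f ⊠ g" (at level 35, right associativity).

Record linear_category (k : fieldType) := LinearCategory {
  obj :> Type;
  hom : obj -> obj -> vectType k;
  idm : forall X, hom X X;
  comp : forall X Y Z, hom Y Z -> hom X Y -> hom X Z;
  comp_id_l : forall X Y (f : hom X Y), comp (idm Y) f = f;
  comp_id_r : forall X Y (f : hom X Y), comp f (idm X) = f;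
  comp_assoc : forall X Y Z W (h : hom Z W) (g : hom Y Z) (f : hom X Y),
    comp h (comp g f) = comp (comp h g) f;
  comp_linear_l : forall X Y Z (f : hom X Y),
    linear (fun g : hom Y Z => comp g f);
  comp_linear_r : forall X Y Z (g : hom Y Z),
    linear (fun f : hom X Y => comp g f)
}.

Arguments hom {k C} X Y : rename.
Arguments idm {k C} X : rename.
Arguments comp {k C X Y Z} g f : rename.

Notation "g ∘ f" := (comp g f) : cat_scope.
Local Open Scope cat_scope.

Section LinearCategoryTheory.
Variables (k : fieldType) (C : linear_category k).
Implicit Types X Y Z : C.

Record iso X Y := Iso {
  fwd : hom X Y;
  bwd : hom Y X;
  bwd_fwd : bwd ∘ fwd = idm X;
  fwd_bwd : fwd ∘ bwd = idm Y
}.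

Definition is_iso X Y (f : hom X Y) := exists i : iso X Y, fwd i = f.

Definition isomorphic X Y := exists f : hom X Y, is_iso f.

Definition mono X Y (f : hom X Y) :=
  forall Z (g h : hom Z X), f ∘ g = f ∘ h -> g = h.

Definition epi X Y (f : hom X Y) :=
  forall Z (g h : hom Y Z), g ∘ f = h ∘ f -> g = h.

Definition is_kernel X Y (f : hom X Y) K (i : hom K X) :=
  f ∘ i = 0 /\
  forall Z (g : hom Z X), f ∘ g = 0 -> exists! h : hom Z K, i ∘ h = g.

Definition is_cokernel X Y (f : hom X Y) Q (p : hom Y Q) :=
  p ∘ f = 0 /\
  forall Z (g : hom Y Z), g ∘ f = 0 -> exists! h : hom Q Z, h ∘ p = g.

Definition is_zero_object X :=
  forall Y, (forall f : hom X Y, f = 0) /\ (forall f : hom Y X, f = 0).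

Definition is_direct_sum (n : nat) (S : 'I_n -> C) X :=
  exists (inj : forall i, hom (S i) X) (proj : forall i, hom X (S i)),
    [/\ forall i, proj i ∘ inj i = idm (S i),
        forall i j, i <> j -> proj j ∘ inj i = 0
      & \sum_(i < n) (inj i ∘ proj i) = idm X].

(* The empty direct sum ([n = 0]) is a zero object. *)
Definition abelian_category :=
  [/\ forall (n : nat) (S : 'I_n -> C), exists X, is_direct_sum S X,
      forall X Y (f : hom X Y), exists K (i : hom K X), is_kernel f i,
      forall X Y (f : hom X Y), exists Q (p : hom Y Q), is_cokernel f p,
      forall X Y (i : hom X Y), mono i ->
        exists Z (f : hom Y Z), is_kernel f i
    & forall X Y (p : hom X Y), epi p ->
        exists Z (f : hom Z X), is_cokernel f p].

Definition simple X :=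
  ~ is_zero_object X /\
  forall Y (i : hom Y X), mono i -> is_zero_object Y \/ is_iso i.

Definition semisimple_category :=
  abelian_category /\
  forall X, exists (n : nat) (S : 'I_n -> C),
    (forall i, simple (S i)) /\ is_direct_sum S X.

Definition endo_pow X (f : hom X X) (n : nat) : hom X X :=
  iter n (fun g => f ∘ g) (idm X).

End LinearCategoryTheory.

Record monoidal_category (k : fieldType) := MonoidalCategory {
  mon_cat :> linear_category k;
  unit_obj : mon_cat;
  tens : mon_cat -> mon_cat -> mon_cat;
  tensm : forall X X' Y Y' : mon_cat,
    hom X X' -> hom Y Y' -> hom (tens X Y) (tens X' Y');
  tensm_id : forall X Y : mon_cat,
    tensm (idm X) (idm Y) = idm (tens X Y);
  tensm_comp : forall (X X' X'' Y Y' Y'' : mon_cat)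
      (f' : hom X' X'') (f : hom X X') (g' : hom Y' Y'') (g : hom Y Y'),
    tensm (f' ∘ f) (g' ∘ g) = tensm f' g' ∘ tensm f g;
  tensm_linear_l : forall (X X' Y Y' : mon_cat) (g : hom Y Y'),
    linear (fun f : hom X X' => tensm f g);
  tensm_linear_r : forall (X X' Y Y' : mon_cat) (f : hom X X'),
    linear (fun g : hom Y Y' => tensm f g);
  assoc : forall X Y Z : mon_cat,
    iso (tens (tens X Y) Z) (tens X (tens Y Z));
  lunit : forall X : mon_cat, iso (tens unit_obj X) X;
  runit : forall X : mon_cat, iso (tens X unit_obj) X;
  assoc_natural : forall (X X' Y Y' Z Z' : mon_cat)
      (f : hom X X') (g : hom Y Y') (h : hom Z Z'),
    fwd (assoc X' Y' Z') ∘ tensm (tensm f g) h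
    = tensm f (tensm g h) ∘ fwd (assoc X Y Z);
  lunit_natural : forall (X X' : mon_cat) (f : hom X X'),
    fwd (lunit X') ∘ tensm (idm unit_obj) f = f ∘ fwd (lunit X);
  runit_natural : forall (X X' : mon_cat) (f : hom X X'),
    fwd (runit X') ∘ tensm f (idm unit_obj) = f ∘ fwd (runit X);
  pentagon : forall W X Y Z : mon_cat,
    fwd (assoc W X (tens Y Z)) ∘ fwd (assoc (tens W X) Y Z)
    = tensm (idm W) (fwd (assoc X Y Z)) ∘ fwd (assoc W (tens X Y) Z)
      ∘ tensm (fwd (assoc W X Y)) (idm Z);
  triangle : forall X Y : mon_cat,
    tensm (idm X) (fwd (lunit Y)) ∘ fwd (assoc X unit_obj Y)
    = tensm (fwd (runit X)) (idm Y)
}.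

Arguments unit_obj {k C} : rename.
Arguments tens {k C} X Y : rename.
Arguments tensm {k C X X' Y Y'} f g : rename.
Arguments assoc {k C} X Y Z : rename.
Arguments lunit {k C} X : rename.
Arguments runit {k C} X : rename.

Notation "X ⊗ Y" := (tens X Y) : cat_scope.
Notation "f ⊠ g" := (tensm f g) : cat_scope.

(* [dual_pair D X]: [D] is a left dual of [X]; equivalently, [X] is a right
   dual of [D]. *)
Record dual_pair (k : fieldType) (C : monoidal_category k) (D X : C) :=
  DualPair {
  ev : hom (D ⊗ X) unit_obj;
  coev : hom unit_obj (X ⊗ D);
  zigzag_l :
    fwd (runit X) ∘ (idm X ⊠ ev) ∘ fwd (assoc X D X) ∘ (coev ⊠ idm X)
      ∘ bwd (lunit X) = idm X;
  zigzag_r :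
    fwd (lunit D) ∘ (ev ⊠ idm D) ∘ bwd (assoc D X D) ∘ (idm D ⊠ coev)
      ∘ bwd (runit D) = idm D
}.

Record rigid_category (k : fieldType) := RigidCategory {
  rigid_mon :> monoidal_category k;
  ldual : rigid_mon -> rigid_mon;
  ldualP : forall X, dual_pair (ldual X) X;
  rdual : rigid_mon -> rigid_mon;
  rdualP : forall X, dual_pair X (rdual X)
}.

Arguments ldual {k C} X : rename.
Arguments ldualP {k C} X : rename.
Arguments rdual {k C} X : rename.
Arguments rdualP {k C} X : rename.

Definition dual_mor (k : fieldType) (C : rigid_category k) (X Y : C)
    (f : hom X Y) : hom (ldual Y) (ldual X) :=
  fwd (lunit (ldual X))
  ∘ (ev (ldualP Y) ⊠ idm (ldual X))
  ∘ ((idm (ldual Y) ⊠ f) ⊠ idm (ldual X))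
  ∘ bwd (assoc (ldual Y) X (ldual X))
  ∘ (idm (ldual Y) ⊠ coev (ldualP X))
  ∘ bwd (runit (ldual Y)).

Record fusion_category (k : fieldType) := FusionCategory {
  fus_rigid :> rigid_category k;
  fus_semisimple : semisimple_category fus_rigid;
  fus_finite : exists (n : nat) (S : 'I_n -> fus_rigid),
    forall X, simple X -> exists i, isomorphic X (S i);
  fus_unit_simple : simple (unit_obj : fus_rigid);
  fus_end_simple : forall X : fus_rigid, simple X ->
    bijective (fun a : k => a *: idm X)
}.

Record braiding (k : fieldType) (C : monoidal_category k) := Braiding {
  braid : forall X Y : C, iso (X ⊗ Y) (Y ⊗ X);
  braid_natural : forall (X X' Y Y' : C) (f : hom X X') (g : hom Y Y'),
    fwd (braid X' Y') ∘ (f ⊠ g) = (g ⊠ f) ∘ fwd (braid X Y);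
  hexagon_r : forall X Y Z : C,
    fwd (assoc Y Z X) ∘ fwd (braid X (Y ⊗ Z)) ∘ fwd (assoc X Y Z)
    = (idm Y ⊠ fwd (braid X Z)) ∘ fwd (assoc Y X Z)
      ∘ (fwd (braid X Y) ⊠ idm Z);
  hexagon_l : forall X Y Z : C,
    bwd (assoc Z X Y) ∘ fwd (braid (X ⊗ Y) Z) ∘ bwd (assoc X Y Z)
    = (fwd (braid X Z) ⊠ idm Y) ∘ bwd (assoc X Z Y)
      ∘ (idm X ⊠ fwd (braid Y Z))
}.

Definition monodromy (k : fieldType) (C : monoidal_category k)
    (c : braiding C) (V W : C) : hom (V ⊗ W) (V ⊗ W) :=
  fwd (braid c W V) ∘ fwd (braid c V W).

Record twist (k : fieldType) (C : rigid_category k) (c : braiding C) := Twist {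
  tw : forall V : C, iso V V;
  tw_natural : forall (V W : C) (f : hom V W),
    fwd (tw W) ∘ f = f ∘ fwd (tw V);
  tw_tens : forall V W : C,
    fwd (tw (V ⊗ W))
    = (fwd (tw V) ⊠ fwd (tw W)) ∘ fwd (braid c W V) ∘ fwd (braid c V W);
  tw_unit : fwd (tw unit_obj) = idm unit_obj;
  tw_dual : forall V : C, fwd (tw (ldual V)) = dual_mor (fwd (tw V))
}.

Definition is_least_pos (P : nat -> Prop) (n : nat) :=
  [/\ (0 < n)%N, P n & forall m, (0 < m)%N -> P m -> (n <= m)%N].

(* As for the order of a group element, the value is 0 when no positive
   integer satisfies [P]. *)
Definition least_pos (P : nat -> Prop) : nat :=
  xget 0%N [set n | is_least_pos P n]%classic.

Definition ord_twist (k : fieldType) (C : rigid_category k) (c : braiding C)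
    (theta : twist c) : nat :=
  least_pos (fun n => forall V : C, endo_pow (fwd (tw theta V)) n = idm V).

Definition ord_monodromy (k : fieldType) (C : monoidal_category k)
    (c : braiding C) : nat :=
  least_pos (fun n =>
    forall V W : C, endo_pow (monodromy c V W) n = idm (V ⊗ W)).

(* Main.v *)
From mathcomp Require Import all_boot all_order all_algebra.
From mathcomp Require Import boolp classical_sets reals complex.
From mathcomp Require Import zify.
Require Import Defs.

(** Naturality of the braiding gives
    [theta_(V ⊗ W)^n = (theta_V^n ⊠ theta_W^n) M_(V,W)^n], so [theta^n = 1]
    implies [M^n = 1]. Conversely let [M^m = 1] and let [V] be simple, with
    [theta_V = t]. Then [theta] is [t] on the dual of [V] as well, so that
    [theta^m] is [t^(2m)] on [V ⊗ V^*]; comparing with [theta_1 = 1] along the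
    coevaluation gives [t^(2m) = 1], and semisimplicity gives
    [theta^(2m) = 1]. Hence [ord M <= ord theta <= 2 ord M]. Finally [M] to the
    power [ord theta - ord M] is trivial, so this difference is either [0] or
    at least [ord M]. *)

Set Implicit Arguments.
Unset Strict Implicit.
Unset Printing Implicit Defensive.

Import GRing.Theory.
Local Open Scope ring_scope.
Local Open Scope cat_scope.

Section LinearCategory.
Variables (k : fieldType) (C : linear_category k).
Implicit Types X Y Z : C.

Lemma compZl X Y Z (a : k) (g : hom Y Z) (f : hom X Y) :
  (a *: g) ∘ f = a *: (g ∘ f).
Proof. exact: (GRing.scalable_linear (comp_linear_l f)). Qed.

Lemma compZr X Y Z (a : k) (g : hom Y Z) (f : hom X Y) :
  g ∘ (a *: f) = a *: (g ∘ f).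
Proof. exact: (GRing.scalable_linear (comp_linear_r g)). Qed.

Lemma comp_sumr X Y Z n (g : hom Y Z) (F : 'I_n -> hom X Y) :
  g ∘ (\sum_(i < n) F i) = \sum_(i < n) (g ∘ F i).
Proof.
apply: (big_morph (fun f : hom X Y => g ∘ f)) => [u v|].
  by have := comp_linear_r g 1 u v; rewrite !scale1r.
by rewrite -[in LHS](scale0r (0 : hom X Y)) compZr scale0r.
Qed.

Lemma endo_powD X (f : hom X X) m n :
  endo_pow f (m + n) = endo_pow f m ∘ endo_pow f n.
Proof.
elim: m => [|m IHm]; first by rewrite comp_id_l.
by rewrite addSn /= -comp_assoc -IHm.
Qed.

Lemma endo_powSr X (f : hom X X) n : endo_pow f n.+1 = endo_pow f n ∘ f.
Proof. by rewrite -addn1 endo_powD /= comp_id_r. Qed.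

(** Lifts naturality of the twist to its powers, both along a coevaluation and along the inclusions
    of simple summands. *)
Lemma endo_pow_intertwine X Y (f : hom X X) (g : hom Y Y) (h : hom X Y) n :
  g ∘ h = h ∘ f -> endo_pow g n ∘ h = h ∘ endo_pow f n.
Proof.
move=> gh; elim: n => [|n IHn]; first by rewrite /= comp_id_l comp_id_r.
by rewrite endo_powSr -comp_assoc gh comp_assoc IHn -comp_assoc -endo_powSr.
Qed.

Lemma endo_pow_comp X (f g : hom X X) n :
  g ∘ f = f ∘ g -> endo_pow (f ∘ g) n = endo_pow f n ∘ endo_pow g n.
Proof.
move=> gf; elim: n => [|n IHn]; first by rewrite /= comp_id_l.
rewrite endo_powSr IHn (endo_powSr f) [endo_pow g n.+1]/= -!comp_assoc.
congr (_ ∘ _).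
by rewrite comp_assoc (endo_pow_intertwine n gf) -comp_assoc -endo_powSr.
Qed.

Lemma endo_powZ X (a : k) (f : hom X X) n :
  endo_pow (a *: f) n = a ^+ n *: endo_pow f n.
Proof.
elim: n => [|n IHn]; first by rewrite /= scale1r.
by rewrite !endo_powSr IHn compZl compZr scalerA exprSr.
Qed.

Lemma endo_pow_id X n : endo_pow (idm X) n = idm X.
Proof. by elim: n => [//|n IHn]; rewrite endo_powSr IHn comp_id_l. Qed.

End LinearCategory.

Section MonoidalCategory.
Variables (k : fieldType) (C : monoidal_category k).
Implicit Types X Y : C.

Lemma tensmZl X X' Y Y' (a : k) (f : hom X X') (g : hom Y Y') :
  (a *: f) ⊠ g = a *: (f ⊠ g).
Proof. exact: (GRing.scalable_linear (tensm_linear_l g)). Qed.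

Lemma tensmZr X X' Y Y' (a : k) (f : hom X X') (g : hom Y Y') :
  f ⊠ (a *: g) = a *: (f ⊠ g).
Proof. exact: (GRing.scalable_linear (tensm_linear_r f)). Qed.

Lemma endo_pow_tensm X Y (f : hom X X) (g : hom Y Y) n :
  endo_pow (f ⊠ g) n = endo_pow f n ⊠ endo_pow g n.
Proof.
elim: n => [|n IHn]; first by rewrite /= tensm_id.
by rewrite !endo_powSr IHn tensm_comp.
Qed.

(* The left-hand side of [zigzag_l] is linear in the coevaluation. *)
Lemma coev_scale_id (D X : C) (P : dual_pair D X) (a : k) :
  a *: coev P = coev P -> a *: idm X = idm X.
Proof.
by move=> aP; rewrite -(zigzag_l P) -[in RHS]aP tensmZl compZr compZl.
Qed.

Lemma monodromy_natural (c : braiding C) X Y (f : hom X X) (g : hom Y Y) :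
  monodromy c X Y ∘ (f ⊠ g) = (f ⊠ g) ∘ monodromy c X Y.
Proof.
by rewrite /monodromy -comp_assoc braid_natural comp_assoc braid_natural
           comp_assoc.
Qed.

End MonoidalCategory.

(** The scalar moves out of the composite by bilinearity, and what remains is [zigzag_r]. *)
Lemma dual_morZ_id (k : fieldType) (C : rigid_category k) (X : C) (a : k) :
  dual_mor (a *: idm X) = a *: idm (ldual X).
Proof.
rewrite /dual_mor tensmZr tensmZl !(compZr, compZl) !tensm_id comp_id_r.
by rewrite zigzag_r.
Qed.

Section Twist.
Variables (k : fieldType) (C : rigid_category k) (c : braiding C).
Variable theta : twist c.

(** The monodromy commutes with [f ⊠ g] for endomorphisms [f] and [g], so the power of the product
    in [tw_tens] splits. *)
Lemma endo_pow_twist_tens (V W : C) n :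
  endo_pow (fwd (tw theta (V ⊗ W))) n =
  (endo_pow (fwd (tw theta V)) n ⊠ endo_pow (fwd (tw theta W)) n)
  ∘ endo_pow (monodromy c V W) n.
Proof.
rewrite tw_tens -comp_assoc -/(monodromy c V W) endo_pow_comp.
  by rewrite endo_pow_tensm.
exact: monodromy_natural.
Qed.

Lemma monodromy_pow_twist n :
  (forall V : C, endo_pow (fwd (tw theta V)) n = idm V) ->
  forall V W : C, endo_pow (monodromy c V W) n = idm (V ⊗ W).
Proof.
move=> thn V W; have := endo_pow_twist_tens V W n.
by rewrite !thn tensm_id comp_id_l.
Qed.

Lemma scalar_twist_pow (V : C) (t : k) n :
  fwd (tw theta V) = t *: idm V ->
  endo_pow (monodromy c V (ldual V)) n = idm (V ⊗ ldual V) ->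
  endo_pow (fwd (tw theta V)) (n + n) = idm V.
Proof.
move=> thV Mn; rewrite thV endo_powZ endo_pow_id.
apply: (@coev_scale_id _ _ _ _ (ldualP V)).
(* As the twist is trivial on the unit, its [n]-th power on [V ⊗ ldual V] fixes the coevaluation;
   each tensor factor contributes [t ^+ n]. *)
have := endo_pow_intertwine n (tw_natural theta (coev (ldualP V))).
rewrite tw_unit endo_pow_id comp_id_r endo_pow_twist_tens Mn comp_id_r.
rewrite tw_dual thV dual_morZ_id !endo_powZ !endo_pow_id tensmZl tensmZr.
by rewrite tensm_id scalerA compZl comp_id_l exprD.
Qed.

End Twist.

Lemma twist_pow_monodromy (k : fieldType) (C : fusion_category k)
    (c : braiding C) (theta : twist c) n :
  (forall V W : C, endo_pow (monodromy c V W) n = idm (V ⊗ W)) ->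
  forall V : C, endo_pow (fwd (tw theta V)) (n + n) = idm V.
Proof.
move=> Mn V; have [_ /(_ V)[r [S [simS [inj [proj [_ _ sumV]]]]]]] :=
  fus_semisimple C.
(* Expanding the identity of [V] over its simple summands reduces the claim to each [S i], where the
   twist is a scalar. *)
rewrite -[LHS]comp_id_r -sumV comp_sumr; apply: eq_bigr => i _.
rewrite comp_assoc (endo_pow_intertwine _ (tw_natural theta (inj i))).
have [scal _ scalK] := fus_end_simple (simS i).
rewrite (@scalar_twist_pow _ _ _ _ _ (scal (fwd (tw theta (S i)))) n) //.
by rewrite comp_id_r.
Qed.

(** By well-ordering, the default value 0 occurs only when no positive integer satisfies [P]. *)
Lemma least_posP (P : nat -> Prop) :
  is_least_pos P (least_pos P) \/
  least_pos P = 0%N /\ forall n, (0 < n)%N -> ~ P n.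
Proof.
rewrite /least_pos; case: xgetP => [n _ Pn|noP]; [by left | right].
split=> // n n_gt0 Pn.
have exP : exists n, (0 < n)%N && `[< P n >].
  by exists n; rewrite n_gt0; apply/asboolP.
have [m /andP[m_gt0 /asboolP Pm] m_min] := ex_minnP exP.
apply: (noP m); split=> // j j_gt0 Pj.
by apply: m_min; rewrite j_gt0; apply/asboolP.
Qed.

Lemma monodromy_pow_sub (k : fieldType) (C : monoidal_category k)
    (c : braiding C) m n :
  (m <= n)%N ->
  (forall V W : C, endo_pow (monodromy c V W) m = idm (V ⊗ W)) ->
  (forall V W : C, endo_pow (monodromy c V W) n = idm (V ⊗ W)) ->
  forall V W : C, endo_pow (monodromy c V W) (n - m) = idm (V ⊗ W).
Proof.
move=> le_mn Mm Mn V W.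
by rewrite -(Mn V W) -{2}(subnK le_mn) endo_powD Mm comp_id_r.
Qed.

Theorem proposition6p1 (R : realType) (C : fusion_category (complex R))
    (c : braiding C) (theta : twist c) :
  ord_twist theta = ord_monodromy c \/
  ord_twist theta = (2 * ord_monodromy c)%N.
Proof.
rewrite /ord_twist /ord_monodromy.
set T := (fun n => forall V : C, _); set M := (fun n => forall V W : C, _).
have TM n : T n -> M n := @monodromy_pow_twist _ _ _ theta n.
have MT n : M n -> T (n + n)%N := @twist_pow_monodromy _ _ _ theta n.
(* Infinite orders have value 0. By [TM] and [MT] either both orders are infinite, and then equal,
   or both are finite. *)
have [[o_gt0 To o_min]|[-> noT]] := least_posP T; last first.
  have [[m_gt0 Mm _]|[-> _]] := least_posP M; last by left.
  by case: (noT _ _ (MT _ Mm)); rewrite addn_gt0 m_gt0.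
have [[m_gt0 Mm m_min]|[_ noM]] := least_posP M; last first.
  by case: (noM _ o_gt0 (TM _ To)).
set o := least_pos T in o_gt0 To o_min *.
set m := least_pos M in m_gt0 Mm m_min *.
have le_mo : (m <= o)%N by apply: m_min; last exact: TM.
have le_o2m : (o <= m + m)%N by apply: o_min; [lia | exact: MT].
have Mom : M (o - m)%N by apply: monodromy_pow_sub => //; exact: TM.
have [lt_mo|ge_mo] := ltnP m o; last by left; lia.
(* Now [o - m] is a positive exponent killing the monodromy, so [2m <= o], which meets the bound
   [le_o2m]. *)
have le_m : (m <= o - m)%N by apply: m_min => //; rewrite subn_gt0.
by right; lia.
Qed.
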